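(* Let $P$ be an $n\times n$ irreducible stochastic matrix with stationary distribution vector $\boldsymbol{\pi}$, partitioned as $P=\begin{bmatrix}P_{11}&P_{12}\\P_{21}&P_{22}\end{bmatrix}$ with $P_{11}$ of size $m\times m$ and $P_{22}$ of size $(n-m)\times(n-m)$, $1\le m\le n-1$. Let $P_1=P_{11}+P_{12}(I-P_{22})^{-1}P_{21}$ and $P_2=P_{22}+P_{21}(I-P_{11})^{-1}P_{12}$. Partition $\boldsymbol{\pi}^T=[\boldsymbol{\pi}_1^T\ \boldsymbol{\pi}_2^T]$ conformally and let $\hat{\boldsymbol{\pi}}_i=\boldsymbol{\pi}_i/\|\boldsymbol{\pi}_i\|$. Let $\gamma=\kappa(P)-\kappa(P_1)-\kappa(P_2)$. Then $$\gamma=\|\boldsymbol{\pi}_1\|\,\theta-\|\boldsymbol{\pi}_2\|,$$ where $\theta$ is given by each of the following equivalent expressions: $$\theta=\begin{bmatrix}\mathbf{0}^T&\hat{\boldsymbol{\pi}}_2^T\end{bmatrix}\left(I-P+\begin{bmatrix}\mathbf{1}\\\mathbf{0}\end{bmatrix}\begin{bmatrix}\hat{\boldsymbol{\pi}}_1^T&\mathbf{0}^T\end{bmatrix}\right)^{-1}\begin{bmatrix}\mathbf{0}\\\mathbf{1}\end{bmatrix},$$ $$\theta=\hat{\boldsymbol{\pi}}_2^T\left(I+(I-P_{22})^{-1}P_{21}(I-P_1+\mathbf{1}\hat{\boldsymbol{\pi}}_1^T)^{-1}P_{12}\right)(I-P_{22})^{-1}\mathbf{1},$$ $$\theta=\hat{\boldsymbol{\pi}}_2^T\left(I-P_{22}-P_{21}(I-P_{11}+\mathbf{1}\hat{\boldsymbol{\pi}}_1^T)^{-1}P_{12}\right)^{-1}\mathbf{1},$$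 $$\theta=\hat{\boldsymbol{\pi}}_2^T\left(I-P_2+\frac{1}{1+\hat{\boldsymbol{\pi}}_1^TS\mathbf{1}}\,P_{21}S\mathbf{1}\,\hat{\boldsymbol{\pi}}_1^TSP_{12}\right)^{-1}\mathbf{1},\qquad S=(I-P_{11})^{-1}.$$
   Context: A square nonnegative matrix $P$ is stochastic if $P\mathbf{1}=\mathbf{1}$, where $\mathbf{1}$ is the all-ones vector of appropriate size. The stationary distribution vector of an irreducible stochastic $P$ is the unique vector $\boldsymbol{\pi}$ with $\boldsymbol{\pi}^TP=\boldsymbol{\pi}^T$, $\boldsymbol{\pi}^T\mathbf{1}=1$ (it is entrywise positive). $\|\cdot\|$ denotes the vector 1-norm. Since $P$ is irreducible, $I-P_{11}$ and $I-P_{22}$ are nonsingular, $P_1,P_2$ (the stochastic complements) are stochastic and irreducible, and $\hat{\boldsymbol{\pi}}_i$ is the stationary distribution vector of $P_i$. Kemeny's constant of an irreducible stochastic $N\times N$ matrix $Q$ with eigenvalues $\lambda_1=1,\lambda_2,\dots,\lambda_N$ (with algebraic multiplicity) is $\kappa(Q)=\sum_{i=2}^N\frac{1}{1-\lambda_i}$; equivalently $\kappa(Q)=\operatorname{Tr}\big((I-Q+\mathbf{1}\mathbf{h}^T)^{-1}\big)-1$ for any $\mathbf{h}$ with $\mathbf{h}^T\mathbf{1}=1$. The constant $\gamma$ also equals $[\hat{\boldsymbol{\pi}}_1^T\ {-\hat{\boldsymbol{\pi}}_2^T}](I-P+\mathbf{u}\mathbf{v}^T)^{-1}\begin{bmatrix}\|\boldsymbol{\pi}_2\|\mathbf{1}\\-\|\boldsymbol{\pi}_1\|\mathbf{1}\end{bmatrix}$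 for any $\mathbf{u},\mathbf{v}\in\mathbb{C}^n$ with $\mathbf{v}^T\mathbf{1}\ne0$, $\boldsymbol{\pi}^T\mathbf{u}\ne0$. *)

(* Defs.v *)
From HB Require Import structures.
From mathcomp Require Import all_boot all_order all_algebra.
From mathcomp Require Import complex.
Set Implicit Arguments.
Unset Strict Implicit.
Unset Printing Implicit Defensive.
Import Order.TTheory GRing.Theory Num.Theory.
Local Open Scope ring_scope.
Local Open Scope complex_scope.

Definition ones (R : rcfType) (n : nat) : 'cV[R]_n := const_mx 1.

Definition stochastic (R : rcfType) (n : nat) (Q : 'M[R]_n) : Prop :=
  (forall i j, 0 <= Q i j) /\ Q *m ones R n = ones R n.

(* The digraph with an arc from i to j whenever Q i j <> 0 is strongly
   connected. *)
Definition irreducible_mx (R : rcfType) (n : nat) (Q : 'M[R]_n) : Prop :=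
  forall i j, connect [rel x y | Q x y != 0] i j.

(* The row vector p stands for the transpose of the stationary column vector;
   the second equation is between 1 x 1 matrices. *)
Definition stationary (R : rcfType) (n : nat) (Q : 'M[R]_n) (p : 'rV[R]_n) :
    Prop :=
  p *m Q = p /\ p *m ones R n = 1%:M.

Definition norm1 (R : rcfType) (n : nat) (v : 'rV[R]_n) : R :=
  \sum_j `|v 0 j|.

Definition normalized (R : rcfType) (n : nat) (v : 'rV[R]_n) : 'rV[R]_n :=
  (norm1 v)^-1 *: v.

(* The eigenvalues of Q in R[i], repeated according to their algebraic
   multiplicities. *)
Definition eigenvalues (R : rcfType) (n : nat) (Q : 'M[R]_n) : seq R[i] :=
  sval (closed_field_poly_normal (char_poly (map_mx (real_complex R) Q))).

(* rem deletes a single occurrence of the eigenvalue 1. *)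
Definition kemeny (R : rcfType) (n : nat) (Q : 'M[R]_n) : R[i] :=
  \sum_(z <- rem 1 (eigenvalues Q)) (1 - z)^-1.

(* Main.v *)
(* For M = I - Q + u v invertible, kappa(Q) = tr M^-1 - pi M^-1 1. Apply this to
   P with M = A, to P1 with M = B and to P2 with M = E: E equals D by the
   rank-one update formula for C, and B, D are the two Schur complements of A,
   so that tr A^-1 = tr B^-1 + tr D^-1. Hence
   gamma = 1 + theta - pi A^-1 1, and pi A^-1 1 = 1 + ||pi_2|| (1 + theta)
   follows from A 1 = [1; 0] and pi A = ||pi_1|| [hp1, 0]. *)
Require Import Defs.
From HB Require Import structures.
From mathcomp Require Import all_boot all_order all_algebra.
From mathcomp Require Import complex ring.
Set Implicit Arguments.
Unset Strict Implicit.
Unset Printing Implicit Defensive.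
Import Order.TTheory GRing.Theory Num.Theory.
Local Open Scope ring_scope.
Local Open Scope complex_scope.

(** * Determinants, characteristic polynomials and eigenvalues *)

(** Sylvester's identity: both products in [eqM] equal the block matrix with rows [1, -u] and
    [v, 1], and every factor is block triangular. *)
Lemma det_1addmulmxC (R : comPzRingType) (n q : nat)
    (u : 'M[R]_(n, q)) (v : 'M[R]_(q, n)) :
  \det (1%:M + u *m v) = \det (1%:M + v *m u).
Proof.
have eqM : block_mx 1%:M 0 v 1%:M *m block_mx 1%:M (- u) 0 (1%:M + v *m u)
         = block_mx (1%:M + u *m v) (- u) 0 1%:M *m block_mx 1%:M 0 v 1%:M.
  rewrite !mulmx_block !(mul1mx, mulmx1, mul0mx, mulmx0, addr0, add0r).
  by rewrite mulNmx mulmxN addrK addrCA addNr addr0.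
have := congr1 determinant eqM.
by rewrite !det_mulmx !det_ublock !det_lblock !det1 !mul1r !mulr1.
Qed.

Lemma horner_char_poly (R : comNzRingType) (n : nat) (A : 'M[R]_n) (x : R) :
  (char_poly A).[x] = \det (x%:M - A).
Proof.
rewrite -/(horner_eval x _) /char_poly -det_map_mx; congr (\det _).
apply/matrixP=> i j; rewrite !mxE /= horner_evalE.
by rewrite hornerD hornerN hornerMn hornerX hornerC.
Qed.

(** A nonzero [p - q] would have more distinct roots than its degree allows. Excluding one point
    lets determinant identities be checked only where [x - a] is invertible. *)
Lemma horner_ext_off (F : numFieldType) (a : F) (p q : {poly F}) :
  (forall x, x != a -> p.[x] = q.[x]) -> p = q.
Proof.
move=> eq_pq; apply/eqP; rewrite -subr_eq0; apply/negPn/negP => r_neq0.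
(* The shift by [i.+1] keeps the sample points away from [a]. *)
pose rs := [seq a + i.+1%:R | i <- iota 0 (size (p - q))].
have /(max_poly_roots r_neq0) : all (root (p - q)) rs.
  apply/allP => _ /mapP[i _ ->]; rewrite /root hornerD hornerN eq_pq ?subrr //.
  by rewrite -subr_eq0 addrAC subrr add0r pnatr_eq0.
rewrite size_map size_iota ltnn map_inj_uniq ?iota_uniq; first by move/(_ isT).
by move=> i j /addrI/eqP; rewrite eqr_nat eqSS => /eqP.
Qed.

(* Brauer: replacing Q by Q - u h moves the eigenvalue 1 of u to 0 and keeps
   the others. *)
Lemma char_poly_shift (F : numFieldType) (n : nat) (Q : 'M[F]_n)
    (u : 'cV[F]_n) (h : 'rV[F]_n) :
  Q *m u = u -> h *m u = 1%:M ->
  char_poly Q * 'X = char_poly (Q - u *m h) * ('X - 1%:P).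
Proof.
move=> Qu hu; apply: (@horner_ext_off _ 1) => x x1.
rewrite !hornerM !hornerE !horner_char_poly.
have x10 : x - 1 != 0 by rewrite subr_eq0.
have -> : x%:M - (Q - u *m h)
        = (x%:M - Q) *m (1%:M + ((x - 1)^-1 *: u) *m h).
  rewrite mulmxDr mulmx1 mulmxA -scalemxAr mulmxBl Qu mul_scalar_mx.
  rewrite -{3}[u]scale1r -scalerBl scalerA mulVf // scale1r.
  by rewrite opprB addrCA addrC.
rewrite det_mulmx det_1addmulmxC -scalemxAr hu scalemx1 -raddfD det_scalar1.
by rewrite -mulrA mulrDl mulVf // mul1r subrK.
Qed.

(** The identity [det (x - Y) det (1 - N) = x^n det ((1 - x^-1) - N)] shows that the roots of
    [char_poly Y] are the [(1 - z)^-1]; the trace is minus the subleading coefficient. *)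
Lemma mxtrace_inv_eigen (F : numFieldType) (n : nat) (N : 'M[F]_n)
    (rs : seq F) :
  1%:M - N \in unitmx -> char_poly N = \prod_(z <- rs) ('X - z%:P) ->
  \tr (invmx (1%:M - N)) = \sum_(z <- rs) (1 - z)^-1.
Proof.
move=> N_unit chN; set Y := invmx _.
have sz_rs : size rs = n.
  by apply/eq_add_S; rewrite -(size_char_poly N) chN size_prod_XsubC.
(* A subleading coefficient exists only for [n > 0]. *)
have [n0|n_gt0] := posnP n.
  move: sz_rs; rewrite {1}n0 => /size0nil ->; rewrite big_nil /mxtrace big1 //.
  by move=> i; have := ltn_ord i; rewrite {2}n0.
have detN : \det (1%:M - N) = \prod_(z <- rs) (1 - z).
  rewrite -horner_char_poly chN horner_prod.
  by apply: eq_bigr => z _; rewrite !hornerE.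
have det_neq0 : \det (1%:M - N) != 0 by rewrite -unitfE -unitmxE.
have z1 z : z \in rs -> 1 - z != 0.
  move=> z_rs; apply: contraNneq det_neq0 => z0.
  by rewrite detN (big_rem z) //= z0 mul0r.
have chY : char_poly Y = \prod_(z <- [seq (1 - z)^-1 | z <- rs]) ('X - z%:P).
  apply: (@horner_ext_off _ 0) => x x0; apply: (mulIf det_neq0).
  rewrite horner_char_poly -det_mulmx mulmxBl mulVmx // mul_scalar_mx.
  have -> : x *: (1%:M - N) - 1%:M = x *: ((1 - x^-1)%:M - N).
    rewrite [(1 - _)%:M]raddfB /= !scalerBr !scale_scalar_mx mulfV //.
    by rewrite addrAC.
  rewrite detZ -horner_char_poly chN detN !horner_prod big_map -big_split /=.
  (* The power [x^n] is spread over [rs], one factor per eigenvalue. *)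
  rewrite -{1}sz_rs -(count_predT rs) -iter_mulr_1 -big_const_seq -big_split /=.
  rewrite !big_seq; apply: eq_bigr => z z_rs; rewrite !hornerE.
  by rewrite mulrBl mulVf ?z1 // !mulrBr mulfV // mulr1 addrAC.
apply: oppr_inj; rewrite -char_poly_trace // chY.
rewrite -sz_rs -(size_map (fun z => (1 - z)^-1) rs).
by rewrite coefPn_prod_XsubC ?big_map // size_map sz_rs -lt0n.
Qed.

(** * Kemeny's constant as a trace *)

Lemma eigenvaluesE (R : rcfType) (n : nat) (Q : 'M[R]_n) :
  char_poly (map_mx (real_complex R) Q)
    = \prod_(z <- eigenvalues Q) ('X - z%:P).
Proof.
rewrite /eigenvalues; case: closed_field_poly_normal => rs /= {1}->.
by rewrite (monicP (char_poly_monic _)) scale1r.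
Qed.

(** Subtracting [1 h] from [Q] turns one eigenvalue 1 into 0. That 0 contributes [1 / (1 - 0) = 1]
    to the trace, which is the 1 subtracted here. *)
Lemma kemeny_tr_inv1 (R : rcfType) (n : nat) (Q : 'M[R]_n) (h : 'rV[R]_n) :
    Q *m ones R n = ones R n -> h *m ones R n = 1%:M ->
    1%:M - Q + ones R n *m h \in unitmx ->
  kemeny Q = (\tr (invmx (1%:M - Q + ones R n *m h)) - 1)%:C.
Proof.
move=> Q1 h1 W_unit; set f := real_complex R.
have chQ : char_poly (map_mx f Q) * 'X
         = char_poly (map_mx f (Q - ones R n *m h)) * ('X - 1%:P).
  rewrite map_mxB map_mxM; apply: char_poly_shift.
    by rewrite -map_mxM Q1.
  by rewrite -map_mxM h1 map_scalar_mx rmorph1.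
have := chQ; rewrite !eigenvaluesE.
set es := eigenvalues Q; set rs := eigenvalues _ => eq_prod.
have perm_es : perm_eq (0 :: es) (1 :: rs).
  by apply: prod_XsubC_eq; rewrite !big_cons subr0 mulrC eq_prod mulrC.
(* Membership of 1 ensures that [rem 1] really deletes an eigenvalue. *)
have es1 : 1 \in es.
  have := perm_mem perm_es 1.
  by rewrite !inE eqxx oner_eq0 orFb orTb.
have perm_rs : perm_eq rs (0 :: rem 1 es).
  rewrite -(perm_cons 1) -(permPl perm_es) perm_sym.
  rewrite -[_ :: _]/([:: 1] ++ [:: 0] ++ _) perm_catCA perm_cons perm_sym.
  exact: perm_to_rem.
have opp : 1%:M - Q + ones R n *m h = 1%:M - (Q - ones R n *m h).
  by rewrite opprB addrA addrAC.
have f1 : 1%:M - map_mx f (Q - ones R n *m h)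
        = map_mx f (1%:M - (Q - ones R n *m h)).
  by rewrite [RHS]map_mxB map_scalar_mx rmorph1.
rewrite opp in W_unit *.
have := @mxtrace_inv_eigen _ _ (map_mx f (Q - ones R n *m h)) rs.
rewrite eigenvaluesE f1 map_unitmx => /(_ W_unit erefl).
rewrite -map_invmx trace_map_mx (perm_big _ perm_rs) big_cons subr0 invr1.
move=> trE; rewrite /f rmorphB rmorph1 -/f trE addrAC subrr add0r.
by rewrite /kemeny.
Qed.

Lemma mulmx_mid11 (R : comNzRingType) (n q : nat) (A : 'M[R]_(n, 1))
    (b : 'M[R]_1) (C : 'M[R]_(1, q)) :
  A *m b *m C = b 0 0 *: (A *m C).
Proof. by rewrite {1}[b]mx11_scalar mul_mx_scalar scalemxAl. Qed.

Lemma mulmx_left11 (R : comNzRingType) (q : nat) (b : 'M[R]_1)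
    (C : 'M[R]_(1, q)) :
  b *m C = b 0 0 *: C.
Proof. by rewrite {1}[b]mx11_scalar mul_scalar_mx. Qed.

(** [p] annihilates [1 - Q]. Read through the inverse, this expresses [p] by [v]. *)
Lemma stationary_perturb_row (R : rcfType) (n : nat) (Q : 'M[R]_n)
    (p v : 'rV[R]_n) (u : 'cV[R]_n) :
  stationary Q p -> p *m (1%:M - Q + u *m v) = (p *m u) 0 0 *: v.
Proof.
case=> pQ _; rewrite mulmxDr mulmxBr mulmx1 pQ subrr add0r mulmxA.
by rewrite mulmx_left11.
Qed.

(* With J = 1 p and X the inverse of I - Q + u v, the inverse of I - Q + J is
   (I - J) X (I - J) + J, because v X is a multiple of p. *)
Lemma kemeny_perturb (R : rcfType) (n : nat) (Q : 'M[R]_n) (p v : 'rV[R]_n)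
    (u : 'cV[R]_n) :
    Q *m ones R n = ones R n -> stationary Q p ->
    1%:M - Q + u *m v \in unitmx ->
  let X := invmx (1%:M - Q + u *m v) in
  kemeny Q = (\tr X - (p *m X *m ones R n) 0 0)%:C.
Proof.
move=> Q1 pst; have [pQ p1] := pst.
set M := _ + _ => M_unit X; set e := ones R n in Q1 p1 *.
pose J := e *m p; pose G := 1%:M - J.
have pG : p *m G = 0 by rewrite mulmxBr mulmx1 mulmxA p1 mul1mx subrr.
have JG : J *m G = 0 by rewrite -mulmxA pG mulmx0.
have GG : G *m G = G by rewrite {1}/G mulmxBl mul1mx JG subr0.
have LJ : (1%:M - Q) *m J = 0 by rewrite mulmxA mulmxBl mul1mx Q1 subrr mul0mx.
have pM : p *m M = (p *m u) 0 0 *: v by apply: stationary_perturb_row.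
have p_neq0 : p != 0.
  by apply: contra_eq_neq p1 => ->; rewrite mul0mx eq_sym oner_neq0.
(* Otherwise the nonzero row [p] would be annihilated by the invertible [M]. *)
have pu : (p *m u) 0 0 != 0.
  apply: contraNneq p_neq0 => pu0.
  by rewrite -[p](mulmxK M_unit) pM pu0 scale0r mul0mx.
have vXG : v *m X *m G = 0.
  apply: (scalerI pu); rewrite scaler0 !scalemxAl -pM.
  by rewrite mulmxK.
have LX : (1%:M - Q) *m X = 1%:M - u *m (v *m X).
  by apply/(canRL (addrK _)); rewrite mulmxA -mulmxDl mulmxV.
have WZ : (1%:M - Q + J) *m (G *m X *m G + J) = 1%:M.
  have JJ : J *m J = J by rewrite mulmxA -(mulmxA e) p1 mulmx1.
  move: (1%:M - Q) LJ LX => L LJ LX.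
  rewrite mulmxDl [L *m _]mulmxDr [J *m _]mulmxDr LJ JJ addr0 !mulmxA JG.
  rewrite !mul0mx add0r.
  have -> : L *m G = L by rewrite {1}/G mulmxBr mulmx1 LJ subr0.
  by rewrite LX mulmxBl mul1mx -(mulmxA u) vXG mulmx0 subr0 subrK.
have [W_unit _] := mulmx1_unit WZ.
rewrite (kemeny_tr_inv1 Q1 p1) //; congr (_%:C).
have -> : invmx (1%:M - Q + J) = G *m X *m G + J.
  by rewrite -[RHS](mulKmx W_unit) WZ mulmx1.
(* Cyclicity and [G G = G] reduce the first trace to that of [X G]; the trace 1 of [J] cancels the
   subtracted 1. *)
rewrite mxtraceD -mulmxA mxtrace_mulC -(mulmxA X) GG mulmxBr mulmx1 raddfB /=.
rewrite mulmxA mxtrace_mulC mulmxA trace_mx11 [\tr J]mxtrace_mulC p1.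
by rewrite trace_mx11 [1%:M 0 0]mxE eqxx addrK.
Qed.

(** * Inverses of block matrices and rank-one updates *)

(** Block elimination with pivot [d], whose Schur complement is [B]. The lower right block is
    written through [B] because this is the shape of the second expression for theta. *)
Lemma invmx_block_ul (F : fieldType) (m k : nat) (a : 'M[F]_m)
    (b : 'M[F]_(m, k)) (c : 'M[F]_(k, m)) (d : 'M[F]_k) :
    block_mx a b c d \in unitmx -> d \in unitmx ->
  let Y := invmx (block_mx a b c d) in
  let B := a - b *m invmx d *m c in
  [/\ B \in unitmx, ulsubmx Y = invmx B
    & drsubmx Y = (1%:M + invmx d *m c *m invmx B *m b) *m invmx d].
Proof.
move=> M_unit d_unit Y B.
have MY : block_mx a b c d *m Y = 1%:M by rewrite mulmxV.
have YM : Y *m block_mx a b c d = 1%:M by rewrite mulVmx.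
rewrite -[Y]submxK !mulmx_block scalar_mx_block in MY YM.
move: MY YM; set Y11 := ulsubmx Y; set Y12 := ursubmx Y.
set Y21 := dlsubmx Y; set Y22 := drsubmx Y.
move=> /eq_block_mx[MY11 _ MY21 MY22] /eq_block_mx[_ YM12 _ _].
(* This block is taken from [Y M = 1]; the corresponding equation of [M Y = 1] would need an inverse
   of [a]. *)
have eY12 : Y12 = - (Y11 *m b *m invmx d).
  apply/eqP; rewrite -addr_eq0 -[Y12](mulmxK d_unit) -mulmxDl addrC.
  by rewrite YM12 mul0mx.
have eY21 : Y21 = - (invmx d *m c *m Y11).
  apply/eqP; rewrite -addr_eq0 -[Y21](mulKmx d_unit) -mulmxA -mulmxDr addrC.
  by rewrite MY21 mulmx0.
have BY : B *m Y11 = 1%:M.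
  by rewrite mulmxBl -!mulmxA (mulmxA _ c) -mulmxN -eY21.
have [B_unit _] := mulmx1_unit BY.
have eY11 : Y11 = invmx B by rewrite -[Y11](mulKmx B_unit) BY mulmx1.
split=> //; rewrite -eY11 //.
rewrite -[Y22](mulKmx d_unit) -[d *m Y22](addKr (c *m Y12)) MY22 eY12.
rewrite mulmxN opprK mulmxDr mulmx1 addrC mulmxDl mul1mx.
by rewrite !mulmxA.
Qed.

(** The same elimination with pivot [a]. The two pivots describe one block of the inverse in two
    ways. *)
Lemma invmx_block_dr (F : fieldType) (m k : nat) (a : 'M[F]_m)
    (b : 'M[F]_(m, k)) (c : 'M[F]_(k, m)) (d : 'M[F]_k) :
    block_mx a b c d \in unitmx -> a \in unitmx ->
  let Y := invmx (block_mx a b c d) in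
  let D := d - c *m invmx a *m b in
  D \in unitmx /\ drsubmx Y = invmx D.
Proof.
move=> M_unit a_unit Y D.
have MY : block_mx a b c d *m Y = 1%:M by rewrite mulmxV.
rewrite -[Y]submxK mulmx_block scalar_mx_block in MY.
have [_ MY12 _ MY22] := eq_block_mx MY.
have eY12 : ursubmx Y = - (invmx a *m b *m drsubmx Y).
  apply/eqP; rewrite -addr_eq0 -[ursubmx Y](mulKmx a_unit) -mulmxA -mulmxDr.
  by rewrite MY12 mulmx0.
have DY : D *m drsubmx Y = 1%:M.
  rewrite mulmxBl -!mulmxA (mulmxA _ b) -mulmxN -eY12 addrC.
  exact: MY22.
have [D_unit _] := mulmx1_unit DY.
by split=> //; rewrite -[LHS](mulKmx D_unit) DY mulmx1.
Qed.

(** The Sherman-Morrison formula; for square matrices a one-sided check of the product suffices. *)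
Lemma invmx_rank1_update (F : fieldType) (n : nat) (T : 'M[F]_n)
    (u : 'cV[F]_n) (v : 'rV[F]_n) :
  let S := invmx T in let s := 1 + (v *m S *m u) 0 0 in
  T \in unitmx -> s != 0 ->
  T + u *m v \in unitmx
  /\ invmx (T + u *m v) = S - s^-1 *: (S *m u *m v *m S).
Proof.
move=> S s T_unit s0; set Z := S - _.
have TZ : (T + u *m v) *m Z = 1%:M.
  have eTS : T *m (S *m u *m v *m S) = u *m v *m S.
    by rewrite !mulmxA mulmxV ?mul1mx.
  have euv : u *m v *m (S *m u *m v *m S) = (v *m S *m u) 0 0 *: (u *m v *m S).
    by rewrite -(mulmxA u v S) -mulmx_mid11 !mulmxA.
  rewrite mulmxBr -scalemxAr !mulmxDl eTS euv mulmxV //.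
  rewrite -{2}[u *m v *m S]scale1r -scalerDl -/s scalerA mulVf // scale1r.
  by rewrite addrK.
have [M_unit _] := mulmx1_unit TZ.
by split=> //; rewrite -[RHS](mulKmx M_unit) TZ mulmx1.
Qed.

(** * Maximum principle for irreducible stochastic matrices *)

Lemma stochastic_sum (R : rcfType) (n : nat) (Q : 'M[R]_n) (i : 'I_n) :
  stochastic Q -> \sum_j Q i j = 1.
Proof.
case=> _ /matrixP/(_ i 0); rewrite !mxE => <-.
by apply: eq_bigr => j _; rewrite mxE mulr1.
Qed.

(** If the maximum of [g] is nonzero, every arc from a maximizer leads to another maximizer. A path
    to [z], where [g] vanishes, then gives a contradiction. *)
Lemma irreducible_max_principle (R : rcfType) (n : nat) (Q : 'M[R]_n)
    (Z : pred 'I_n) (z : 'I_n) (g : 'I_n -> R) :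
    stochastic Q -> irreducible_mx Q -> Z z ->
    (forall i, 0 <= g i) -> (forall i, Z i -> g i = 0) ->
    (forall i, ~~ Z i -> g i <= \sum_j Q i j * g j) ->
  forall i, g i = 0.
Proof.
move=> Qst Qirr Zz g_ge0 gZ g_sub; have [Q_ge0 _] := Qst.
case: (arg_maxP g (erefl : xpredT z)) => i0 _ i0_max.
have g_max i : g i <= g i0 by apply: i0_max.
suff g0 : g i0 = 0.
  by move=> i; apply/eqP; rewrite eq_le g_ge0 andbT -g0 g_max.
have step i j : g i = g i0 -> g i0 != 0 -> Q i j != 0 -> g j = g i0.
  move=> gi g0 Qij; have nZi : ~~ Z i.
    by apply: contraNN g0 => /gZ <-; rewrite gi.
  have diff_ge0 l : true -> 0 <= Q i l * (g i0 - g l).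
    by move=> _; rewrite mulr_ge0 ?subr_ge0 ?g_max.
  (* The average of [g] along row [i] reaches the maximum, so the nonnegative deficits sum to 0 and
     each of them vanishes. *)
  have : \sum_l Q i l * (g i0 - g l) = 0.
    apply: le_anti; rewrite sumr_ge0 // andbT.
    under eq_bigr do rewrite mulrBr.
    rewrite big_split sumrN -mulr_suml stochastic_sum // mul1r subr_le0 -gi.
    exact: g_sub.
  move/psumr_eq0P => /(_ diff_ge0 j isT)/eqP.
  by rewrite mulf_eq0 (negPf Qij) subr_eq0 => /eqP.
have [//|g0] := eqVneq (g i0) 0.
have /connectP[s s_path z_last] := Qirr i0 z.
suff path_g l i : path [rel x y | Q x y != 0] i l -> g i = g i0 ->
    g (last i l) = g i0 by rewrite -(path_g s i0) // -z_last gZ.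
elim: l i => //= j l IHl i /andP[Qij l_path] gi.
by apply: IHl => //; apply: step Qij.
Qed.

Lemma unitmx_ker (F : fieldType) (n : nat) (A : 'M[F]_n) :
  (forall x : 'cV_n, A *m x = 0 -> x = 0) -> A \in unitmx.
Proof.
move=> kerA; rewrite -unitmx_tr unitmxE unitfE; apply/det0P => -[v v0 vA].
move/eqP: v0; apply; apply: trmx_inj; rewrite trmx0; apply: kerA.
by rewrite -[A]trmxK -trmx_mul vA trmx0.
Qed.

Section Irreducible.
Variables (R : rcfType) (n : nat) (Q : 'M[R]_n).
Hypotheses (Qst : stochastic Q) (Qirr : irreducible_mx Q).

(** By the triangle inequality [|x i - x z|] is at most its own average, and it vanishes at [z]. *)
Lemma harmonic_const (x : 'cV[R]_n) (z : 'I_n) :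
  Q *m x = x -> x = x z 0 *: ones R n.
Proof.
move=> Qx; have [Q_ge0 _] := Qst.
have x_const i : `|x i 0 - x z 0| = 0.
  move: i; apply: (irreducible_max_principle Qst Qirr (Z := pred1 z) (z := z));
    rewrite //=.
  - by move=> _ /eqP->; rewrite subrr normr0.
  - move=> i _.
    have -> : x i 0 - x z 0 = \sum_j Q i j * (x j 0 - x z 0).
      under eq_bigr do rewrite mulrBr.
      rewrite big_split sumrN -mulr_suml stochastic_sum // mul1r -{1}Qx.
      by rewrite mxE.
    apply: le_trans (ler_norm_sum _ _ _) _.
    by apply: ler_sum => j _; rewrite normrM (ger0_norm (Q_ge0 i j)).
apply/colP=> i; rewrite !mxE mulr1; apply/eqP.
by rewrite -subr_eq0 -normr_eq0 x_const.
Qed.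

(** * Principal submatrices that omit an index *)

Section Submatrix.
Variables (q : nat) (f : 'I_q -> 'I_n) (z : 'I_n).
Hypotheses (f_inj : injective f) (zNf : z \notin codom f).

(** Extended by zero off the image of [f], the function [g] satisfies the inequality for all of [Q];
    the omitted index [z] supplies the boundary. *)
Lemma submx_max_principle (g : 'I_q -> R) :
    (forall a, 0 <= g a) -> (forall a, g a <= \sum_b Q (f a) (f b) * g b) ->
  forall a, g a = 0.
Proof.
(* Each fibre of [f] has at most one element, so [h] is the extension by zero. *)
move=> g_ge0 g_sub; pose h i := \sum_(a | f a == i) g a.
have hf a : h (f a) = g a.
  by rewrite /h (big_pred1 a) // => b; rewrite inj_eq.
suff h0 : forall i, h i = 0 by move=> a; rewrite -hf h0.
pose Z := [pred i | i \notin codom f].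
apply: (irreducible_max_principle Qst Qirr (Z := Z) (z := z)) => //=.
- by move=> i; apply: sumr_ge0.
- by move=> i iNf; apply: big1 => a /eqP fa; rewrite -fa codom_f in iNf.
move=> i /negPn/codomP[a ->]; rewrite hf (le_trans (g_sub a)) //.
rewrite le_eqVlt; apply/orP; left; apply/eqP.
rewrite (partition_big f xpredT) //=; apply: eq_bigr => j _.
by rewrite mulr_sumr; apply: eq_bigr => b /eqP->.
Qed.

Let T := 1%:M - mxsub f f Q.

(** For [x] in the kernel, the absolute values of its entries satisfy the maximum principle. *)
Lemma submx_unit : T \in unitmx.
Proof.
have [Q_ge0 _] := Qst; apply: unitmx_ker => x Tx.
have {Tx} Qx : x = mxsub f f Q *m x.
  by apply/eqP; rewrite -subr_eq0 -{1}[x]mul1mx -mulmxBl Tx.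
suff x0 : forall a, `|x a 0| = 0.
  by apply/colP=> a; rewrite mxE; apply/eqP; rewrite -normr_eq0 x0.
apply: submx_max_principle => // a; rewrite {1}Qx mxE.
apply: le_trans (ler_norm_sum _ _ _) _.
by apply: ler_sum => b _; rewrite normrM mxE (ger0_norm (Q_ge0 _ _)).
Qed.

(** Since [y] is 1 plus its average under the submatrix, its negative part is at most its own
    average and vanishes. This later makes [s] positive. *)
Lemma submx_inv_ones_ge0 a : 0 <= (invmx T *m ones R q) a 0.
Proof.
have [Q_ge0 _] := Qst; set y := invmx T *m _.
have yE b : y b 0 = 1 + \sum_c Q (f b) (f c) * y c 0.
  have : T *m y = ones R q by rewrite mulKVmx ?submx_unit.
  rewrite mulmxBl mul1mx => /(canRL (subrK _))/colP/(_ b); rewrite !mxE => ->.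
  by congr (_ + _); apply: eq_bigr => c _; rewrite mxE.
suff y0 : forall b, Num.max 0 (- y b 0) = 0.
  by rewrite -oppr_le0 -(y0 a) le_max lexx orbT.
apply: submx_max_principle => b; first by rewrite le_max lexx.
rewrite ge_max; apply/andP; split.
  by apply: sumr_ge0 => c _; rewrite mulr_ge0 // le_max lexx.
rewrite yE opprD -sumrN -[leRHS]add0r lerD ?lerN10 //.
by apply: ler_sum => c _; rewrite -mulrN ler_wpM2l // le_max lexx orbT.
Qed.

End Submatrix.

(** * Uniqueness and positivity of the stationary vector *)

Variable p : 'rV[R]_n.
Hypothesis pst : stationary Q p.

(** Multiplying [M x = 0] by [p] gives [v x = 0], hence [Q x = x] and [x] is constant; then
    [v 1 != 0] forces [x = 0]. *)
Lemma irreducible_perturb_unit (u : 'cV[R]_n) (v : 'rV[R]_n) :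
    (p *m u) 0 0 != 0 -> (v *m ones R n) 0 0 != 0 ->
  1%:M - Q + u *m v \in unitmx.
Proof.
move=> pu v1; apply: unitmx_ker => x Mx.
have vx : v *m x = 0.
  apply: (scalerI pu); rewrite scaler0 scalemxAl.
  by rewrite -(stationary_perturb_row v u pst) -mulmxA Mx mulmx0.
move: Mx; rewrite mulmxDl -mulmxA vx mulmx0 addr0 mulmxBl mul1mx => /eqP.
rewrite subr_eq0 => /eqP Qx.
apply/colP=> z; move: vx; rewrite (@harmonic_const x z) // -scalemxAr.
move=> /matrixP/(_ 0 0); rewrite !mxE mulr1 => /eqP; rewrite mulf_eq0.
case/orP=> [/eqP//|].
by move: v1; rewrite mxE => /negPf ->.
Qed.

(** The invertible matrix [1 - Q + 1 p] sends both [q] and [p] to [p]. *)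
Lemma stationary_unique (q : 'rV[R]_n) : stationary Q q -> q = p.
Proof.
move=> qst; have [_ q1] := qst; have [_ p1] := pst.
have W_unit : 1%:M - Q + ones R n *m p \in unitmx.
  by apply: irreducible_perturb_unit; rewrite p1 mxE oner_neq0.
apply: (can_inj (mulmxK W_unit)); rewrite !stationary_perturb_row //.
by rewrite q1 p1.
Qed.

(** Entrywise [|p| <= |p| Q], and the totals agree because rows sum to 1. So [|p|] is invariant, and
    by uniqueness its normalization is [p]. *)
Lemma stationary_ge0 j : 0 <= p 0 j.
Proof.
have [Q_ge0 _] := Qst; have [pQ p1] := pst.
pose r := map_mx Num.norm p.
have norm_ge1 : 1 <= norm1 p.
  have <- : `|\sum_i p 0 i| = 1.
    have := congr1 (fun M : 'M_1 => M 0 0) p1; rewrite !mxE eqxx.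
    by under eq_bigr do rewrite mxE mulr1; move=> ->; rewrite normr1.
  exact: ler_norm_sum.
have norm_gt0 : 0 < norm1 p by apply: lt_le_trans norm_ge1.
have le_r i : true -> 0 <= (r *m Q) 0 i - r 0 i.
  move=> _; rewrite subr_ge0 [r 0 i]mxE -{1}pQ !mxE.
  apply: le_trans (ler_norm_sum _ _ _) _.
  by apply: ler_sum => l _; rewrite normrM mxE (ger0_norm (Q_ge0 _ _)).
have sum_r : \sum_i ((r *m Q) 0 i - r 0 i) = 0.
  rewrite big_split sumrN /=; apply/eqP; rewrite subr_eq0; apply/eqP.
  under eq_bigr do rewrite mxE.
  rewrite exchange_big; apply: eq_bigr => i _ /=.
  by rewrite -mulr_sumr stochastic_sum // mulr1.
have rQ : r *m Q = r.
  apply/rowP=> i; apply/eqP; rewrite -subr_eq0; apply/eqP.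
  exact: (psumr_eq0P le_r sum_r).
have rst : stationary Q ((norm1 p)^-1 *: r).
  split; first by rewrite -scalemxAl rQ.
  have -> : ((norm1 p)^-1 *: r) *m ones R n = ((norm1 p)^-1 * norm1 p)%:M.
    rewrite -scalemxAl -scale_scalar_mx; congr (_ *: _).
    apply/matrixP=> a b; rewrite !ord1 !mxE eqxx mulr1n.
    by apply: eq_bigr => i _; rewrite !mxE mulr1.
  by rewrite mulVf // gt_eqF.
rewrite -(stationary_unique rst) !mxE mulr_ge0 ?normr_ge0 //.
by rewrite invr_ge0 ltW.
Qed.

(** A zero entry propagates backwards along arcs. As every index reaches [j], all of [p] would
    vanish, against [p 1 = 1]. *)
Lemma stationary_gt0 j : 0 < p 0 j.
Proof.
have [Q_ge0 _] := Qst; have [pQ p1] := pst.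
rewrite lt_def stationary_ge0 andbT; apply/eqP => pj.
have step i l : Q i l != 0 -> p 0 l = 0 -> p 0 i = 0.
  move=> Qil; rewrite -{1}pQ mxE => /psumr_eq0P/(_ i isT) pQi.
  suff /eqP : p 0 i * Q i l = 0.
    by rewrite mulf_eq0 (negPf Qil) orbF => /eqP.
  by apply: pQi => a _; rewrite mulr_ge0 // stationary_ge0.
have p0 i : p 0 i = 0.
  have /connectP[s s_path j_last] := Qirr i j.
  move: pj; rewrite {}j_last.
  elim: s i s_path => //= l s IHs i /andP[Qil s_path].
  by move/(IHs _ s_path); apply: step.
move/matrixP/(_ 0 0): p1; rewrite !mxE big1 => [/eqP|i _].
  by rewrite eq_sym oner_eq0.
by rewrite p0 mul0r.
Qed.

End Irreducible.

(** * Normalization and stochastic complements *)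

Lemma mulmx_ones_norm1 (R : rcfType) (n : nat) (v : 'rV[R]_n) :
  (forall j, 0 <= v 0 j) -> v *m ones R n = (norm1 v)%:M.
Proof.
move=> v_ge0; apply/matrixP=> i j; rewrite !ord1 !mxE eqxx mulr1n.
by apply: eq_bigr => l _; rewrite mxE mulr1 ger0_norm.
Qed.

Lemma norm1_gt0 (R : rcfType) (n : nat) (v : 'rV[R]_n) :
  (0 < n)%N -> (forall j, 0 < v 0 j) -> 0 < norm1 v.
Proof.
move=> n_gt0 v_gt0; rewrite /norm1 (bigD1 (Ordinal n_gt0)) //=.
rewrite ltr_pwDl ?sumr_ge0 //.
by rewrite normr_gt0 gt_eqF.
Qed.

Lemma stationary_normalized (R : rcfType) (n : nat) (Q : 'M[R]_n)
    (v : 'rV[R]_n) :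
  (0 < n)%N -> (forall j, 0 < v 0 j) -> v *m Q = v ->
  stationary Q (normalized v).
Proof.
move=> n_gt0 v_gt0 vQ; split; rewrite /normalized -scalemxAl ?vQ //.
rewrite mulmx_ones_norm1 => [|j]; last exact: ltW.
by rewrite scale_scalar_mx mulVf // gt_eqF // norm1_gt0.
Qed.

(** Eliminates [y] through [c x = (1 - d) y]. It serves [P1], and with the two blocks exchanged also
    [P2]. *)
Lemma stochastic_complement_ones (F : fieldType) (m k : nat) (a : 'M[F]_m)
    (b : 'M[F]_(m, k)) (c : 'M[F]_(k, m)) (d : 'M[F]_k)
    (x : 'cV[F]_m) (y : 'cV[F]_k) :
    1%:M - d \in unitmx -> a *m x + b *m y = x -> c *m x + d *m y = y ->
  (a + b *m invmx (1%:M - d) *m c) *m x = x.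
Proof.
move=> d_unit rowa rowc.
have cx : c *m x = (1%:M - d) *m y.
  by rewrite mulmxBl mul1mx -{1}rowc addrK.
by rewrite mulmxDl -!mulmxA cx mulKmx.
Qed.

(** The left-hand counterpart, which makes [hp1] and [hp2] stationary for [P1] and [P2]. *)
Lemma stochastic_complement_row (F : fieldType) (m k : nat) (a : 'M[F]_m)
    (b : 'M[F]_(m, k)) (c : 'M[F]_(k, m)) (d : 'M[F]_k)
    (x : 'rV[F]_m) (y : 'rV[F]_k) :
    1%:M - d \in unitmx -> x *m a + y *m c = x -> x *m b + y *m d = y ->
  x *m (a + b *m invmx (1%:M - d) *m c) = x.
Proof.
move=> d_unit cola colb.
have xb : x *m b = y *m (1%:M - d).
  by rewrite mulmxBr mulmx1 -{1}colb addrK.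
by rewrite mulmxDr !mulmxA xb mulmxK.
Qed.

(** [invmx] returns a singular matrix unchanged and the inverse of 0 is 0, so the conclusion also
    asserts that every inverted matrix is invertible and that [s] is nonzero. *)
Theorem proposition3p4 (R : rcfType) (m k : nat) (hm : (0 < m)%N)
    (hk : (0 < k)%N) (P : 'M[R]_(m + k)) (p : 'rV[R]_(m + k))
    (Pstoch : stochastic P) (Pirr : irreducible_mx P)
    (pstat : stationary P p) :
  let P11 := ulsubmx P in
  let P12 := ursubmx P in
  let P21 := dlsubmx P in
  let P22 := drsubmx P in
  let P1 := P11 + P12 *m invmx (1%:M - P22) *m P21 in
  let P2 := P22 + P21 *m invmx (1%:M - P11) *m P12 in
  let p1 := lsubmx p in
  let p2 := rsubmx p in
  let hp1 := normalized p1 in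
  let hp2 := normalized p2 in
  let e1 := ones R m in
  let e2 := ones R k in
  let gamma := kemeny P - kemeny P1 - kemeny P2 in
  let S := invmx (1%:M - P11) in
  let s := 1 + (hp1 *m S *m e1) 0 0 in
  let A := 1%:M - P + col_mx e1 0 *m row_mx hp1 0 in
  let B := 1%:M - P1 + e1 *m hp1 in
  let C := 1%:M - P11 + e1 *m hp1 in
  let D := 1%:M - P22 - P21 *m invmx C *m P12 in
  let E := 1%:M - P2
             + s^-1 *: (P21 *m S *m e1 *m hp1 *m S *m P12) in
  [/\ 1%:M - P11 \in unitmx, 1%:M - P22 \in unitmx &
      [/\ A \in unitmx, B \in unitmx, C \in unitmx, D \in unitmx
        & E \in unitmx] /\ s != 0]
  /\ exists theta : R,
      gamma = (norm1 p1 * theta - norm1 p2)%:C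
      /\ [/\ theta = (row_mx 0 hp2 *m invmx A *m col_mx 0 e2) 0 0,
             theta = (hp2 *m (1%:M + invmx (1%:M - P22) *m P21
                                       *m invmx B *m P12)
                          *m invmx (1%:M - P22) *m e2) 0 0,
             theta = (hp2 *m invmx D *m e2) 0 0
           & theta = (hp2 *m invmx E *m e2) 0 0].
Proof.
move=> P11 P12 P21 P22 P1 P2 p1 p2 hp1 hp2 e1 e2 gamma S s A B C D E.
have p_gt0 := stationary_gt0 Pstoch Pirr pstat.
have p1_gt0 j : 0 < p1 0 j by rewrite mxE.
have p2_gt0 j : 0 < p2 0 j by rewrite mxE.
(* Each diagonal block omits an index of the other, nonempty block. *)
have N1 : rshift m (Ordinal hk) \notin codom (@lshift m k).
  by apply/codomP => -[i /eqP]; rewrite eq_rlshift.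
have N2 : lshift k (Ordinal hm) \notin codom (@rshift m k).
  by apply/codomP => -[i /eqP]; rewrite eq_lrshift.
have P11E : P11 = mxsub (@lshift m k) (@lshift m k) P by apply: ulsubmxEsub.
have P22E : P22 = mxsub (@rshift m k) (@rshift m k) P by apply: drsubmxEsub.
have L1_unit : 1%:M - P11 \in unitmx.
  by rewrite P11E (submx_unit Pstoch Pirr (@lshift_inj m k) N1).
have L2_unit : 1%:M - P22 \in unitmx.
  by rewrite P22E (submx_unit Pstoch Pirr (@rshift_inj m k) N2).
have Se1_ge0 j : 0 <= (S *m e1) j 0.
  by rewrite /S P11E (submx_inv_ones_ge0 Pstoch Pirr (@lshift_inj m k) N1).
have ones_col : ones R (m + k) = col_mx e1 e2 by rewrite col_mx_const.
have [pP pe] := pstat; have [_ Pe] := Pstoch.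
move: pP; rewrite -{1 2}[p]hsubmxK -{1}[P]submxK mul_row_block => pP.
have {pP} [p1P p2P] := eq_row_mx pP.
move: Pe; rewrite ones_col -{1}[P]submxK mul_block_col => Pe.
have {Pe} [Pe1 Pe2] := eq_col_mx Pe.
move: pe; rewrite ones_col -{1}[p]hsubmxK mul_row_col => pe.
rewrite -/p1 -/p2 in p1P p2P pe.
rewrite -/P11 -/P12 -/P21 -/P22 in p1P p2P Pe1 Pe2.
have a_gt0 := norm1_gt0 hm p1_gt0; have b_gt0 := norm1_gt0 hk p2_gt0.
set a := norm1 p1 in a_gt0 *; set b := norm1 p2 in b_gt0 *.
have a0 : a != 0 by rewrite gt_eqF.
have b0 : b != 0 by rewrite gt_eqF.
have p1e : p1 *m e1 = a%:M by apply: mulmx_ones_norm1 => j; apply: ltW.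
have p2e : p2 *m e2 = b%:M by apply: mulmx_ones_norm1 => j; apply: ltW.
have ab : a + b = 1.
  by move/matrixP/(_ 0 0): pe; rewrite p1e p2e !mxE eqxx !mulr1n.
have hst1 : stationary P1 hp1.
  apply: stationary_normalized => //.
  exact: stochastic_complement_row L2_unit p1P p2P.
have hst2 : stationary P2 hp2.
  apply: stationary_normalized => //.
  by apply: (stochastic_complement_row (y := p1) L1_unit); rewrite addrC.
have P1e : P1 *m e1 = e1 by apply: stochastic_complement_ones Pe1 Pe2.
have P2e : P2 *m e2 = e2.
  by apply: (stochastic_complement_ones (y := e1)); rewrite // addrC.
have [_ h1] := hst1; have [_ h2] := hst2.
rewrite -/e1 -/e2 in h1 h2.
pose u := col_mx e1 (0 : 'cV[R]_k); pose v := row_mx hp1 (0 : 'rV[R]_k).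
have pu : p *m u = a%:M.
  by rewrite -[p]hsubmxK mul_row_col mulmx0 addr0 p1e.
have ve : v *m ones R (m + k) = 1%:M.
  by rewrite ones_col mul_row_col mul0mx addr0.
have A_unit : A \in unitmx.
  apply: (irreducible_perturb_unit Pstoch Pirr pstat).
    by rewrite pu mxE eqxx mulr1n.
  by rewrite ve mxE oner_neq0.
have AE : A = block_mx C (- P12) (- P21) (1%:M - P22).
  rewrite /A -[P in LHS]submxK scalar_mx_block opp_block_mx add_block_mx.
  by rewrite mul_col_row add_block_mx !mulmx0 !mul0mx !addr0 !add0r.
have s_gt0 : 0 < s.
  apply: ltr_pwDl => //; rewrite -mulmxA mxE.
  apply: sumr_ge0 => j _; apply: mulr_ge0 => //.
  by rewrite mxE mulr_ge0 ?invr_ge0 //; apply: ltW.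
have s0 : s != 0 by rewrite gt_eqF.
have [C_unit invC] := invmx_rank1_update L1_unit s0.
rewrite -/C -/S -/s in C_unit invC.
have A_unit' := A_unit; rewrite AE in A_unit'.
(* Two eliminations on the same [A]: pivot [1 - P22] leads to the second expression for theta, pivot
   [C] to the third. *)
have [B_unit X11 X22] := invmx_block_ul A_unit' L2_unit.
have [D_unit X22'] := invmx_block_dr A_unit' C_unit.
move: B_unit X11 X22 D_unit X22'; rewrite -AE.
have -> : C - - P12 *m invmx (1%:M - P22) *m - P21 = B.
  by rewrite mulmxN !mulNmx opprK /B /P1 opprD /C addrAC [in RHS]addrA.
have -> : 1%:M - P22 - - P21 *m invmx C *m - P12 = D.
  by rewrite mulmxN !mulNmx opprK.
set X := invmx A => B_unit X11 X22 D_unit X22'.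
have DE : D = E.
  rewrite /D invC mulmxBr mulmxBl opprB /E /P2 opprD -scalemxAr -scalemxAl.
  by rewrite !mulmxA addrA addrAC [in RHS]addrA.
have E_unit : E \in unitmx by rewrite -DE.
split; first by do !split.
(* The third expression is the witness; the lower right block of [X] ties it to the first two, and
   [D = E] to the last. *)
pose theta := (hp2 *m invmx D *m e2) 0 0.
have theta1 : theta = (row_mx 0 hp2 *m X *m col_mx 0 e2) 0 0.
  rewrite -[X]submxK mul_row_block !mul0mx !add0r mul_row_col mulmx0 add0r.
  by rewrite X22'.
exists theta; split; last first.
  split=> //; last by rewrite -DE.
  by rewrite /theta -X22' X22 !(mulmxN, mulNmx) opprK !mulmxA.
have kP : kemeny P = (\tr X - (p *m X *m ones R (m + k)) 0 0)%:C.
  exact: (kemeny_perturb Pstoch.2 pstat A_unit).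
have kP1 : kemeny P1 = (\tr (invmx B) - 1)%:C by apply: kemeny_tr_inv1.
have kP2 : kemeny P2 = (\tr (invmx D) - theta)%:C.
  (* Seen as a rank-one perturbation of [1 - P2], [E] makes theta the term [hp2 E^-1 e2] that
     [kemeny_perturb] subtracts. *)
  have EE : E = 1%:M - P2 + (P21 *m S *m e1) *m (s^-1 *: (hp1 *m S *m P12)).
    by rewrite -scalemxAr !mulmxA.
  rewrite /theta DE EE; apply: kemeny_perturb => //.
  by rewrite -EE.
have trX : \tr X = \tr (invmx B) + \tr (invmx D).
  by rewrite -[X]submxK mxtrace_block X11 X22'.
have pX : p = a *: (v *m X).
  rewrite scalemxAl -[p in LHS](mulmxK A_unit).
  by rewrite (stationary_perturb_row v u pstat) pu mxE eqxx mulr1n.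
have Xu : X *m u = ones R (m + k).
  rewrite -[RHS](mulKmx A_unit); congr (_ *m _).
  rewrite mulmxDl mulmxBl mul1mx Pstoch.2 subrr add0r -mulmxA ve.
  by rewrite mulmx1.
pose w := col_mx (0 : 'cV[R]_m) e2.
have pw : p *m w = b%:M by rewrite -[p]hsubmxK mul_row_col mulmx0 add0r p2e.
have pE : p = a *: v + b *: row_mx 0 hp2.
  rewrite !scale_row_mx !scaler0 add_row_mx addr0 add0r !scalerA !mulfV //.
  by rewrite !scale1r hsubmxK.
have pXe : (p *m X *m ones R (m + k)) 0 0 = 1 + b + b * theta.
  have -> : ones R (m + k) = u + w by rewrite ones_col add_col_mx addr0 add0r.
  (* In [p = a v + b [0, hp2]] the first summand gives [a v X w = p w = b], the second gives
     [b theta]. *)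
  have pXw : p *m X *m w = b%:M + b *: (row_mx 0 hp2 *m X *m w).
    rewrite [p in LHS]pE !mulmxDl -!scalemxAl; congr (_ + _).
    by rewrite scalemxAl -pX pw.
  rewrite mulmxDr -mulmxA Xu pstat.2 pXw theta1.
  by rewrite !mxE eqxx !mulr1n -addrA.
rewrite /gamma kP kP1 kP2 -!rmorphB /=; congr (_%:C).
(* Here [a] is replaced by [1 - b], as the two norms sum to 1. *)
by rewrite pXe trX -[a](addrK b) ab; ring.
Qed.
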